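(* Let $\Pi$ be a probability measure on $\mathsf{X}\times\mathsf{Y}\times\mathsf{Z}$. Let $\tilde\Gamma$ be the block Gibbs Markov chain with transition kernel $$K\big((x,y,z),(\mathrm{d}x',\mathrm{d}y',\mathrm{d}z')\big)=\Pi_{Z|XY}(\mathrm{d}z'|x',y')\,\Pi_{XY|Z}(\mathrm{d}x',\mathrm{d}y'|z)$$ and let $\Gamma^*$ be the out-of-order block Gibbs Markov chain with transition kernel $$K^*\big((y,z,x),(\mathrm{d}y',\mathrm{d}z',\mathrm{d}x')\big)=\Pi_{X|Z}(\mathrm{d}x'|z')\,\Pi_{Z|XY}(\mathrm{d}z'|x,y')\,\Pi_{Y|XZ}(\mathrm{d}y'|x,z),$$ under the standing regularity assumptions in the context. Then there are only two possibilities: (i) $\tilde\Gamma$ and $\Gamma^*$ are both geometrically ergodic with the same geometric convergence rate, or (ii) neither chain is geometrically ergodic.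
   Context: Setting. $\mathsf{X},\mathsf{Y},\mathsf{Z}$ are measurable spaces with countably generated $\sigma$-algebras, and $\Pi(\mathrm{d}x,\mathrm{d}y,\mathrm{d}z)$ is a probability measure on $\mathsf{X}\times\mathsf{Y}\times\mathsf{Z}$, viewed as the law of a random vector $(X,Y,Z)$. Subscripts denote marginals ($\Pi_{XY}$, $\Pi_{YZ}$, $\Pi_Z$, etc.) and regular conditional distributions: $\Pi_{X|Z}(\mathrm{d}x|z)$, $\Pi_{Y|XZ}(\mathrm{d}y|x,z)$, $\Pi_{Z|XY}(\mathrm{d}z|x,y)$ are fixed Markov kernels that are versions of the respective conditional distributions under $\Pi$, and $\Pi_{XY|Z}(\mathrm{d}x,\mathrm{d}y|z)=\Pi_{X|Z}(\mathrm{d}x|z)\,\Pi_{Y|XZ}(\mathrm{d}y|x,z)$ for every $z$. The chain $\tilde\Gamma$ lives on $\mathsf{X}\times\mathsf{Y}\times\mathsf{Z}$ and has invariant distribution $\Pi$. The chain $\Gamma^*$ lives on $\mathsf{Y}\times\mathsf{Z}\times\mathsf{X}$ and has invariant distribution $\Pi^*(\mathrm{d}x,\mathrm{d}y,\mathrm{d}z)=\Pi_{X|Z}(\mathrm{d}x|z)\,\Pi_{YZ}(\mathrm{d}y,\mathrm{d}z)$ (measures on $\mathsf{X}\times\mathsf{Y}\times\mathsf{Z}$ and on $\mathsf{Y}\times\mathsf{Z}\times\mathsf{X}$ are identified by permuting coordinates). Standing assumptions. The following Markov chains are assumed irreducible, aperiodic and positive Harris recurrent: those with kernels $K$ and $K^*$,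 and also the marginal chains of $\tilde\Gamma$, with kernels $K_{XY}\big((x,y),(\mathrm{d}x',\mathrm{d}y')\big)=\int_{\mathsf{Z}}\Pi_{XY|Z}(\mathrm{d}x',\mathrm{d}y'|z)\,\Pi_{Z|XY}(\mathrm{d}z|x,y)$ on $\mathsf{X}\times\mathsf{Y}$ and $K_Z(z,\mathrm{d}z')=\int_{\mathsf{X}}\int_{\mathsf{Y}}\Pi_{Z|XY}(\mathrm{d}z'|x,y)\,\Pi_{XY|Z}(\mathrm{d}x,\mathrm{d}y|z)$ on $\mathsf{Z}$. Geometric ergodicity. Let $P$ be a Markov transition kernel on a space $E$ with unique invariant probability measure $\pi$, and let $P^n$ be its $n$-step kernel. The chain is geometrically ergodic if there exist a (measurable) function $M:E\to[0,\infty]$ with $\int_E M\,\mathrm{d}\pi<\infty$ and a $\rho\in[0,1)$ such that $$\|P^n(u,\cdot)-\pi(\cdot)\|\le M(u)\rho^n\quad\text{for all }n\in\mathbb{N}=\{1,2,\dots\}\text{ and all }u\in E,$$ where $\|\cdot\|$ is total variation distance, $\|\mu-\nu\|=\sup_{0\le f\le1}\big|\int f\,\mathrm{d}\mu-\int f\,\mathrm{d}\nu\big|$. The geometric convergence rate $\rho_*$ of the chain is the infimum of all $\rho\in[0,1]$ for which the displayed inequality holds (for all $n\in\mathbb{N}$, $u\in E$) with some $\pi$-integrable $M:E\to[0,\infty]$; the chain is geometrically ergodic if and only if $\rho_*<1$. *)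

(* Defs.v *)
From HB Require Import structures.
From mathcomp Require Import all_boot all_order all_algebra.
From mathcomp Require Import all_classical all_reals all_analysis.
From mathcomp Require Import measurable_realfun.

Set Implicit Arguments.
Unset Strict Implicit.
Unset Printing Implicit Defensive.
Import Order.TTheory GRing.Theory Num.Theory.
Import numFieldNormedType.Exports.

Local Open Scope classical_set_scope.
Local Open Scope ring_scope.
Local Open Scope ereal_scope.

Definition countably_generated (d : measure_display) (T : measurableType d) :=
  exists G : set (set T), countable G /\ d.-measurable = <<s G >>.

Section snd_mfun.
Context d1 d2 (T1 : measurableType d1) (T2 : measurableType d2).
HB.instance Definition _ := isMeasurableFun.Build _ _ (T1 * T2)%type T2 snd
  (@measurable_snd _ _ T1 T2).
End snd_mfun.

Section kpull.
Context d0 d1 d2 (T0 : measurableType d0) (T1 : measurableType d1)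
  (T2 : measurableType d2) (R : realType).
Variables (f : {mfun T0 >-> T1}) (k : R.-pker T1 ~> T2).

Definition kpull : T0 -> {measure set T2 -> \bar R} := fun t => k (f t).

Let measurable_kpull U : measurable U -> measurable_fun [set: T0] (kpull ^~ U).
Proof.
move=> mU; apply: (measurableT_comp (f := k ^~ U) (g := f)) => //.
exact: measurable_kernel.
Qed.

HB.instance Definition _ := @isKernel.Build _ _ _ _ R kpull measurable_kpull.

Let prob_kpull t : kpull t [set: T2] = 1.
Proof. exact: prob_kernel. Qed.

HB.instance Definition _ :=
  @Kernel_isProbability.Build _ _ _ _ R kpull prob_kpull.

End kpull.

(* [kprod k1 k2 t] is k1(t, dx) k2((t, x), dy) *)
Section kprod.
Context d0 d1 d2 (T0 : measurableType d0) (T1 : measurableType d1)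
  (T2 : measurableType d2) (R : realType).
Variables (k1 : R.-pker T0 ~> T1) (k2 : R.-pker (T0 * T1) ~> T2).

Definition kprod : T0 -> {measure set (T1 * T2) -> \bar R} := mkproduct k1 k2.

HB.instance Definition _ :=
  @isKernel.Build _ _ _ _ R kprod (measurable_kproduct k1 k2).

Let prob_kprod t : kprod t [set: T1 * T2] = 1.
Proof.
have k21 x : \int[k2 (t, x)]_y (\1_[set: T1 * T2] (x, y))%:E = 1 :> \bar R.
  transitivity (\int[k2 (t, x)]_y cst (1 : \bar R) y).
    by apply: eq_integral => y _; rewrite indicT.
  by rewrite integral_cst// mul1e prob_kernel.
transitivity (\int[k1 t]_x cst (1 : \bar R) x).
  by apply: eq_integral => x _; exact: k21.
by rewrite integral_cst// mul1e prob_kernel.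
Qed.

HB.instance Definition _ :=
  @Kernel_isProbability.Build _ _ _ _ R kprod prob_kprod.

End kprod.

(* [kseq k1 k2 t] is \int k1(t, dx) k2(x, dy) *)
Section kseq.
Context d0 d1 d2 (T0 : measurableType d0) (T1 : measurableType d1)
  (T2 : measurableType d2) (R : realType).
Variables (k1 : R.-pker T0 ~> T1) (k2 : R.-pker T1 ~> T2).

Definition kseq : T0 -> {measure set T2 -> \bar R} := mkcomp_noparam k1 k2.

Let measurable_kseq U : measurable U -> measurable_fun [set: T0] (kseq ^~ U).
Proof. exact: measurable_kernel. Qed.

HB.instance Definition _ := @isKernel.Build _ _ _ _ R kseq measurable_kseq.

Let prob_kseq t : kseq t [set: T2] = 1.
Proof.
rewrite /kseq /mkcomp_noparam /= /kcomp_noparam.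
transitivity (\int[k1 t]_x cst (1 : \bar R) x).
  by apply: eq_integral => x _; exact: prob_kernel.
by rewrite integral_cst// mul1e prob_kernel.
Qed.

HB.instance Definition _ :=
  @Kernel_isProbability.Build _ _ _ _ R kseq prob_kseq.

End kseq.

(* [mprod mu k] is the probability measure mu(dx) k(x, dy) *)
Section mprod.
Context d1 d2 (T1 : measurableType d1) (T2 : measurableType d2) (R : realType).
Variables (mu : probability T1 R) (k : R.-pker T1 ~> T2).

Definition mprod (A : set (T1 * T2)) : \bar R :=
  \int[mu]_x \int[k x]_y (\1_A (x, y))%:E.

Let kmu : R.-pker unit ~> T1 :=
  kprobability (@measurable_cst _ _ unit _ setT (mu : pprobability T1 R)).

Let mprodE : mprod = kprod kmu (kpull snd k) tt.
Proof. by []. Qed.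

Let mprod0 : mprod set0 = 0.
Proof. by rewrite mprodE measure0. Qed.

Let mprod_ge0 A : 0 <= mprod A.
Proof. by rewrite mprodE measure_ge0. Qed.

Let mprod_sigma_additive : semi_sigma_additive mprod.
Proof. by rewrite mprodE; exact: measure_semi_sigma_additive. Qed.

HB.instance Definition _ := isMeasure.Build _ _ _ mprod
  mprod0 mprod_ge0 mprod_sigma_additive.

Let mprodT : mprod setT = 1.
Proof. by rewrite mprodE prob_kernel. Qed.

HB.instance Definition _ := Measure_isProbability.Build _ _ _ mprod mprodT.

End mprod.

Section markov.
Context d (E : measurableType d) (R : realType).
Implicit Types (P : R.-pker E ~> E) (pi : probability E R)
  (psi : {sigma_finite_measure set E -> \bar R}) (A B : set E).

Fixpoint kpow P (n : nat) : R.-pker E ~> E :=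
  if n is m.+1 then kseq P (kpow P m)
  else kdirac (@measurable_id _ E setT).

Definition invariant_probability P pi :=
  forall A, measurable A -> \int[pi]_x P x A = pi A.

Definition markov_chain P (x : E) d' (O : measurableType d')
    (Pr : probability O R) (Phi : nat -> {mfun O >-> E}) :=
  (forall A, measurable A -> Pr (Phi 0%N @^-1` A) = \d_x A) /\
  (forall n (A : nat -> set E) B,
    (forall i, measurable (A i)) -> measurable B ->
    let past := \bigcap_(i in `I_n.+1) (Phi i @^-1` A i) in
    Pr (past `&` Phi n.+1 @^-1` B) = \int[Pr]_(w in past) P (Phi n w) B).

(* Irreducibility, aperiodicity and Harris recurrence are those of Meyn and
   Tweedie, all taken with respect to one maximal irreducibility measure. *)
Definition irreducibility_measure P psi :=
  0 < psi setT /\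
  forall A, measurable A -> 0 < psi A ->
    forall x, exists2 n, (0 < n)%N & 0 < kpow P n x A.

Definition maximal_irreducibility_measure P psi :=
  irreducibility_measure P psi /\
  forall phi : {sigma_finite_measure set E -> \bar R},
    irreducibility_measure P phi -> phi `<< psi.

Definition cyclic_decomposition P psi (p : nat) (D : nat -> set E) :=
  [/\ forall i, (i < p)%N -> measurable (D i),
      trivIset `I_p D,
      forall i x, (i < p)%N -> D i x -> P x (D (i.+1 %% p)%N) = 1
    & psi (~` \bigcup_(i in `I_p) D i) = 0].

Definition aperiodic P psi :=
  forall p D, (0 < p)%N -> cyclic_decomposition P psi p D -> p = 1%N.

(* The law of the chain is determined by P and its starting point, so one
   realization for each starting point suffices. *)
Definition harris_recurrent P psi :=
  forall x, exists (d' : measure_display) (O : measurableType d')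
      (Pr : probability O R) (Phi : nat -> {mfun O >-> E}),
    markov_chain P x Pr Phi /\
    forall A, measurable A -> 0 < psi A ->
      Pr (lim_sup_set (fun n => Phi n @^-1` A)) = 1.

Definition irreducible_aperiodic_positive_harris P :=
  exists psi, [/\ maximal_irreducibility_measure P psi, aperiodic P psi,
    harris_recurrent P psi & exists pi, invariant_probability P pi].

Definition total_variation_distance (mu nu : {measure set E -> \bar R}) :
    \bar R :=
  ereal_sup [set `|\int[mu]_x (f x)%:E - \int[nu]_x (f x)%:E|
            | f in [set f : E -> R |
                measurable_fun setT f /\ forall x, (0 <= f x <= 1)%R]].

(* When rho = 0 and M u = +oo the bound reads +oo * 0 = 0; reading it as +oo
   instead changes neither of the two notions defined from it. *)
Definition geometric_bound P pi (rho : R) :=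
  exists M : E -> \bar R,
    [/\ forall u, 0 <= M u,
        pi.-integrable setT M
      & forall n u, (0 < n)%N ->
          total_variation_distance (kpow P n u) pi <= M u * (rho ^+ n)%:E].

(* [pi] is meant to be the unique invariant probability measure of P. *)
Definition geometrically_ergodic P pi :=
  exists2 rho : R, (0 <= rho < 1)%R & geometric_bound P pi rho.

Definition geometric_rate P pi : R :=
  inf [set rho : R | (0 <= rho <= 1)%R /\ geometric_bound P pi rho].

End markov.

(* The kernel k is a version of the conditional distribution of U given V. *)
Definition conditional_law (d d1 d2 : measure_display) (O : measurableType d)
    (T1 : measurableType d1) (T2 : measurableType d2) (R : realType)
    (Pr : probability O R) (U : O -> T1) (V : O -> T2) (k : R.-pker T2 ~> T1) :=
  forall A C, measurable A -> measurable C ->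
    Pr (U @^-1` A `&` V @^-1` C) = \int[Pr]_(w in V @^-1` C) k (V w) A.

Section coordinates.
Context dX dY dZ (X : measurableType dX) (Y : measurableType dY)
  (Z : measurableType dZ).

Definition coordX (w : X * Y * Z) := w.1.1.
Definition coordY (w : X * Y * Z) := w.1.2.
Definition coordZ (w : X * Y * Z) := w.2.
Definition coordXY (w : X * Y * Z) := (coordX w, coordY w).
Definition coordXZ (w : X * Y * Z) := (coordX w, coordZ w).
Definition coordYZ (w : X * Y * Z) := (coordY w, coordZ w).

Let measurable_coordYZ : measurable_fun setT coordYZ.
Proof.
apply: measurable_fun_pair => //.
exact: (measurableT_comp measurable_snd measurable_fst).
Qed.

HB.instance Definition _ :=
  isMeasurableFun.Build _ _ _ _ coordYZ measurable_coordYZ.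

(* The maps below feed a conditional kernel from the coordinates available at
   one stage of a sweep; a prime marks a coordinate drawn during that sweep. *)
Definition pair_x'z (u : Z * X) : X * Z := (u.2, u.1).

Let measurable_pair_x'z : measurable_fun setT pair_x'z.
Proof. exact: measurable_fun_pair. Qed.

HB.instance Definition _ :=
  isMeasurableFun.Build _ _ _ _ pair_x'z measurable_pair_x'z.

Definition pair_xz (u : Y * Z * X) : X * Z := (u.2, u.1.2).

Let measurable_pair_xz : measurable_fun setT pair_xz.
Proof.
apply: measurable_fun_pair => //.
exact: (measurableT_comp measurable_snd measurable_fst).
Qed.

HB.instance Definition _ :=
  isMeasurableFun.Build _ _ _ _ pair_xz measurable_pair_xz.

Definition pair_xy' (u : (Y * Z * X) * Y) : X * Y := (u.1.2, u.2).

Let measurable_pair_xy' : measurable_fun setT pair_xy'.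
Proof.
apply: measurable_fun_pair => //.
exact: (measurableT_comp measurable_snd measurable_fst).
Qed.

HB.instance Definition _ :=
  isMeasurableFun.Build _ _ _ _ pair_xy' measurable_pair_xy'.

Definition coord_z' (u : (Y * Z * X) * (Y * Z)) : Z := u.2.2.

Let measurable_coord_z' : measurable_fun setT coord_z'.
Proof. exact: (measurableT_comp measurable_snd measurable_snd). Qed.

HB.instance Definition _ :=
  isMeasurableFun.Build _ _ _ _ coord_z' measurable_coord_z'.

End coordinates.

Section gibbs.
Context dX dY dZ (X : measurableType dX) (Y : measurableType dY)
  (Z : measurableType dZ) (R : realType).
Variables (Pi : probability (X * Y * Z)%type R) (PiX_Z : R.-pker Z ~> X)
  (PiY_XZ : R.-pker (X * Z) ~> Y) (PiZ_XY : R.-pker (X * Y) ~> Z).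

Definition PiXY_Z : R.-pker Z ~> (X * Y)%type :=
  kprod PiX_Z (kpull (@pair_x'z _ _ X Z) PiY_XZ).

Definition K_tilde : R.-pker (X * Y * Z) ~> (X * Y * Z)%type :=
  kprod (kpull snd PiXY_Z) (kpull snd PiZ_XY).

Definition K_star : R.-pker (Y * Z * X) ~> (Y * Z * X)%type :=
  kprod
    (kprod (kpull (@pair_xz _ _ _ X Y Z) PiY_XZ)
           (kpull (@pair_xy' _ _ _ X Y Z) PiZ_XY))
    (kpull (@coord_z' _ _ _ X Y Z) PiX_Z).

Definition K_XY : R.-pker (X * Y) ~> (X * Y)%type := kseq PiZ_XY PiXY_Z.

Definition K_Z : R.-pker Z ~> Z := kseq PiXY_Z PiZ_XY.

Definition Pi_star : probability (Y * Z * X)%type R :=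
  mprod (distribution Pi (@coordYZ _ _ _ X Y Z)) (kpull snd PiX_Z).

End gibbs.

(* Main.v *)
(* Let [update_X] redraw x given z, and [update_YZ] redraw y given (x, z) and
   then z given (x, y).  Then K = update_X update_YZ, K* = update_YZ update_X,
   Pi update_X = Pi* and Pi* update_YZ = Pi, so that
   K^(n+1) = update_X (K* )^n update_YZ.  As Markov kernels contract total
   variation, ||K^(n+1)(u, .) - Pi|| is at most the update_X(u, .)-average of
   ||(K* )^n(v, .) - Pi*||: a bound M rho^n for K* with rho > 0 gives the bound
   ((update_X M + 1) / rho) rho^n for K, and update_X M is Pi-integrable because
   Pi update_X = Pi*.  The argument is symmetric in the two chains. *)

From HB Require Import structures.
From mathcomp Require Import all_boot all_order all_algebra.
From mathcomp Require Import all_classical all_reals all_analysis.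
From mathcomp Require Import measurable_realfun lra.
Require Import Defs.

Set Implicit Arguments.
Unset Strict Implicit.
Unset Printing Implicit Defensive.
Import Order.TTheory GRing.Theory Num.Theory.
Import numFieldNormedType.Exports.

Local Open Scope classical_set_scope.
Local Open Scope ring_scope.
Local Open Scope ereal_scope.

(** * Integration against composed and product kernels *)

Section fst_mfun.
Context d1 d2 (T1 : measurableType d1) (T2 : measurableType d2).
HB.instance Definition _ := isMeasurableFun.Build _ _ (T1 * T2)%type T1 fst
  (@measurable_fst _ _ T1 T2).
End fst_mfun.

Section kernel_integrals.
Context d0 d1 (T0 : measurableType d0) (T1 : measurableType d1) (R : realType).

Lemma measurable_integral_pker (k : R.-pker T0 ~> T1) (f : T1 -> \bar R) :
  (forall y, 0 <= f y) -> measurable_fun setT f ->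
  measurable_fun setT (fun x => \int[k x]_y f y).
Proof.
by move=> f0 mf; apply: measurable_fun_integral_kernel => // U mU;
  exact: measurable_kernel.
Qed.

Lemma integral_kdirac (g : T0 -> T1) (mg : measurable_fun setT g) x
    (f : T1 -> \bar R) :
  measurable_fun setT f ->
  \int[kdirac mg x : {measure set _ -> \bar R}]_y f y = f (g x).
Proof. by move=> mf; rewrite integral_dirac// diracT mul1e. Qed.

End kernel_integrals.

Section kernel_products.
Context d0 d1 d2 (T0 : measurableType d0) (T1 : measurableType d1)
  (T2 : measurableType d2) (R : realType).

Lemma integral_kseq (k1 : R.-pker T0 ~> T1) (k2 : R.-pker T1 ~> T2) x
    (f : T2 -> \bar R) :
  (forall z, 0 <= f z) -> measurable_fun setT f ->
  \int[kseq k1 k2 x]_z f z = \int[k1 x]_y \int[k2 y]_z f z.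
Proof. by move=> f0 mf; rewrite -(integral_kcomp k1 (kpull snd k2)). Qed.

(* The kernel sending [(t, x)] to the law of [(x, V)], V drawn from [k (t, x)],
   turns the product [kprod] into the composition [kcomp]. *)
Let kpair (k : R.-pker (T0 * T1) ~> T2) : R.-pker (T0 * T1) ~> (T1 * T2)%type :=
  kprod (kdirac (@measurable_snd _ _ T0 T1)) (kpull fst k).

Let integral_kpair (k : R.-pker (T0 * T1) ~> T2) t (f : T1 * T2 -> \bar R) :
  (forall w, 0 <= f w) -> measurable_fun setT f ->
  \int[kpair k t]_w f w = \int[k t]_z f (t.2, z).
Proof.
move=> f0 mf; have mt := pair1_measurable (T2 := T2) t.2.
(* [kpair k t] is the image of [k t] under z -> (t.2, z); it suffices to compare the two measures on
   measurable sets. *)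
rewrite -(@ge0_integral_pushforward _ _ _ _ _ _ mt (k t) setT f)//.
apply: eq_measure_integral => A mA _.
rewrite [LHS](@integral_kdirac _ _ _ _ _ _ (@measurable_snd _ _ T0 T1) t
  (fun y => \int[k t]_z (\1_A (y, z))%:E)).
  rewrite /= integral_indic ?setIT// -[X in measurable X]setTI.
  exact: mt.
(* With [t] frozen, [k t] is a constant kernel in y. *)
apply: (@measurable_fun_integral_sfinite_kernel _ _ _ _ _
  (fun w => (\1_A w)%:E) (kpull (cst t) k)) => //.
exact/measurable_EFinP.
Qed.

(** For indicators this is the definition of [kprod]; passing through [kpair] reduces general [f] to
    the integral formula for kernel composition. *)
Lemma integral_kprod (k1 : R.-pker T0 ~> T1) (k2 : R.-pker (T0 * T1) ~> T2) x
    (f : T1 * T2 -> \bar R) :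
  (forall w, 0 <= f w) -> measurable_fun setT f ->
  \int[kprod k1 k2 x]_w f w = \int[k1 x]_y \int[k2 (x, y)]_z f (y, z).
Proof.
move=> f0 mf; transitivity (\int[mkcomp k1 (kpair k2) x]_w f w).
  apply: eq_measure_integral => A mA _; apply: eq_integral => y _ /=.
  transitivity (\int[kpair k2 (x, y)]_w (\1_A w)%:E).
    by rewrite integral_kpair//; exact/measurable_EFinP.
  by rewrite integral_indic// setIT.
rewrite (integral_kcomp k1 (kpair k2))//; apply: eq_integral => y _.
by rewrite integral_kpair.
Qed.

End kernel_products.

Section mprod_integral.
Context d1 d2 (T1 : measurableType d1) (T2 : measurableType d2) (R : realType).

(** A probability is a kernel from the one-point space, so [integral_kprod] applies. *)
Lemma integral_mprod (mu : probability T1 R) (k : R.-pker T1 ~> T2)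
    (f : T1 * T2 -> \bar R) :
  (forall w, 0 <= f w) -> measurable_fun setT f ->
  \int[mprod mu k]_w f w = \int[mu]_x \int[k x]_y f (x, y).
Proof.
pose kmu : R.-pker unit ~> T1 :=
  kprobability (@measurable_cst _ _ unit _ setT (mu : pprobability T1 R)).
exact: (@integral_kprod _ _ _ _ _ _ _ kmu (kpull snd k) tt).
Qed.

End mprod_integral.

(** * From conditional laws on rectangles to integrals *)

Section conditional_integral.
Context d d1 d2 (O : measurableType d) (T1 : measurableType d1)
  (T2 : measurableType d2) (R : realType).
Variables (Pr : probability O R) (U : O -> T1) (V : O -> T2).
Variable k : R.-pker T2 ~> T1.

(** Both sides integrate [f] against a measure on the product: the law of V followed by [k], and the
    joint law of (V, U). [conditional_law] equates these on rectangles, a generating class stable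
    under intersection, hence everywhere. *)
Lemma integral_conditional_law (f : T2 * T1 -> \bar R) :
  measurable_fun setT U -> measurable_fun setT V -> conditional_law Pr U V k ->
  (forall w, 0 <= f w) -> measurable_fun setT f ->
  \int[Pr]_w \int[k (V w)]_u f (V w, u) = \int[Pr]_w f (V w, U w).
Proof.
move=> mU mV UVk f0 mf.
pose V' : {mfun O >-> T2} := HB.pack V (isMeasurableFun.Build _ _ _ _ V mV).
have mVU : measurable_fun setT (fun w => (V w, U w)).
  exact: measurable_fun_pair.
have mkf : measurable_fun setT (fun y => \int[k y]_u f (y, u)).
  exact: (measurable_fun_integral_sfinite_kernel f k).
have kf0 y : 0 <= \int[k y]_u f (y, u) by exact: integral_ge0.
rewrite -(@ge0_integral_distribution _ _ _ _ _ Pr V'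
  (fun y => \int[k y]_u f (y, u)))//.
rewrite -integral_mprod//.
rewrite -[RHS](@ge0_integral_pushforward _ _ _ _ _ _ mVU Pr setT f)//.
apply: eq_measure_integral => A mA _.
pose G := [set C `*` D | C in @measurable _ T2 & D in @measurable _ T1].
apply: (@g_sigma_algebra_measure_unique _ R _ G _ (fun=> setT)) => //.
- by move=> _ [C mC [D mD <-]]; exact: measurableX.
- by move=> _; exists setT => //; exists setT => //; rewrite setXTT.
- by rewrite bigcup_const.
- move=> _ _ [C1 mC1 [D1 mD1 <-]] [C2 mC2 [D2 mD2 <-]].
  exists (C1 `&` C2); first exact: measurableI.
  by exists (D1 `&` D2); [exact: measurableI|rewrite setXI].
- move=> _ [C mC [D mD <-]].
  transitivity (\int[Pr]_w \int[k (V w)]_u (\1_(C `*` D) (V w, u))%:E).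
    rewrite -(@ge0_integral_distribution _ _ _ _ _ Pr V'
      (fun y => \int[k y]_u (\1_(C `*` D) (y, u))%:E))//.
      apply: (@measurable_fun_integral_sfinite_kernel _ _ _ _ _
        (fun w => (\1_(C `*` D) w)%:E) k) => //.
      by apply/measurable_EFinP/measurable_indic; exact: measurableX.
    by move=> y; exact: integral_ge0.
  rewrite [RHS](_ : _ = Pr (U @^-1` D `&` V @^-1` C)); last first.
    by rewrite setIC.
  rewrite UVk// [RHS]integral_mkcond; apply: eq_integral => w _.
  (* Off the preimage of [C] both integrands vanish; on it, the indicator of the rectangle reduces
     to that of [D]. *)
  rewrite patchE; case: ifPn => [|/negP] VC; last first.
    rewrite integral0_eq// => u _; rewrite indicE memNset// => -[/= ? _].
    by apply: VC; rewrite inE.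
  rewrite -[in RHS](setIT D) -integral_indic//; apply: eq_integral => u _.
  by rewrite !indicE in_setX /= (mem_set (set_mem VC : C (V w))).
- move=> _.
  by rewrite [ltLHS](probability_setT (mprod (distribution Pr V') k)) ltry.
- by rewrite -measurable_prod_measurableType.
Qed.

End conditional_integral.

(** * Total variation distance *)

Section total_variation.
Context d (E : measurableType d) (R : realType).

(** Kernel integrals are extended-real test functions, while the supremum ranges over real ones;
    values in [0, 1] are finite, so [fine] loses nothing. *)
Lemma le_total_variation_distance (mu nu : {measure set E -> \bar R})
    (f : E -> \bar R) :
  measurable_fun setT f -> (forall x, 0 <= f x <= 1) ->
  `|\int[mu]_x f x - \int[nu]_x f x| <= total_variation_distance mu nu.
Proof.
move=> mf f01; apply: ereal_sup_ubound; exists (fine \o f) => /=.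
  split=> [|x]; first exact: measurableT_comp (fine_measurable measurableT) mf.
  by have := f01 x; case: (f x) => [r||] //= _; rewrite lexx ler01.
have Ef x : (fine (f x))%:E = f x.
  rewrite fineK// fin_numElt; have /andP[f0 f1] := f01 x.
  by rewrite (lt_le_trans _ f0) ?ltNy0// (le_lt_trans f1) ?ltry.
by congr `|_ - _|; apply: eq_integral => x _; rewrite Ef.
Qed.

Lemma le1_integral (mu : {measure set E -> \bar R}) (f : E -> \bar R) :
  mu setT = 1 -> measurable_fun setT f -> (forall x, 0 <= f x <= 1) ->
  0 <= \int[mu]_x f x <= 1.
Proof.
move=> mu1 mf f01; apply/andP; split.
  by apply: integral_ge0 => x _; have /andP[] := f01 x.
rewrite -[leRHS]mul1e -[X in _ * X]mu1 -integral_cst//.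
by apply: ge0_le_integral => // [x _|x _]; have /andP[] := f01 x.
Qed.

Lemma total_variation_distance_le1 (mu nu : {measure set E -> \bar R}) :
  mu setT = 1 -> nu setT = 1 -> total_variation_distance mu nu <= 1.
Proof.
move=> mu1 nu1; apply: ge_ereal_sup => _ [f [mf f01] <-].
have mEf : measurable_fun setT (EFin \o f) by exact/measurable_EFinP.
have /andP[] := le1_integral mu1 mEf f01.
have /andP[] := le1_integral nu1 mEf f01.
case: (\int[mu]_x _) => // r; case: (\int[nu]_x _) => // s.
rewrite !lee_fin /= => s0 s1 r0 r1; rewrite ler_norml; apply/andP; split.
  by rewrite (@le_trans _ _ (- s)%R) ?lerN2 ?lerDr.
by rewrite (@le_trans _ _ r)// gerBl.
Qed.

(** As [mu] has mass 1, [c] is the integral of a constant, and the triangle inequality for integrals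
    applies. This is what lets total variation bounds be averaged. *)
Lemma abse_integralB_cst_le (mu : {measure set E -> \bar R})
    (f : E -> \bar R) c :
  mu setT = 1 -> measurable_fun setT f -> (forall x, 0 <= f x <= 1) ->
  c \is a fin_num ->
  `|\int[mu]_x f x - c| <= \int[mu]_x `|f x - c|.
Proof.
move=> mu1 mf f01 cfin.
have fi : mu.-integrable setT f.
  apply/integrableP; split=> //; rewrite (eq_integral f) => [|x _]; last first.
    by rewrite gee0_abs//; have /andP[] := f01 x.
  by have /andP[_ /le_lt_trans->] := le1_integral mu1 mf f01; rewrite ?ltry.
have ci : mu.-integrable setT (cst c).
  apply/integrableP; split=> //; rewrite integral_cst// [mu _]mu1 mule1.
  by rewrite -(fineK cfin) ltry.
rewrite -[in leLHS](mule1 c) -[X in c * X]mu1.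
rewrite -integral_cst// -integralB//.
by apply: le_abse_integral => //; exact: emeasurable_funB.
Qed.

End total_variation.

(** * Transfer of geometric bounds between chains B A and A B *)

Section intertwining.
Context d d' (E : measurableType d) (F : measurableType d') (R : realType).
Variables (P : R.-pker E ~> E) (Q : R.-pker F ~> F).
Variables (B : R.-pker E ~> F) (A : R.-pker F ~> E).
Variables (pi : probability E R) (pi' : probability F R).
Hypothesis PE : forall u (f : E -> \bar R),
  (forall x, 0 <= f x) -> measurable_fun setT f ->
  \int[P u]_x f x = \int[B u]_v \int[A v]_x f x.
Hypothesis QE : forall v (f : F -> \bar R),
  (forall x, 0 <= f x) -> measurable_fun setT f ->
  \int[Q v]_x f x = \int[A v]_u \int[B u]_x f x.
Hypothesis pi'E : forall f : F -> \bar R,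
  (forall x, 0 <= f x) -> measurable_fun setT f ->
  \int[pi']_x f x = \int[pi]_u \int[B u]_x f x.
Hypothesis piE : forall f : E -> \bar R,
  (forall x, 0 <= f x) -> measurable_fun setT f ->
  \int[pi]_x f x = \int[pi']_v \int[A v]_x f x.

(** With kernels composed from left to right, P = B A and Q = A B, so (B A)^(n+1) regroups as B (A
    B)^n A. *)
Lemma integral_kpowS n u (f : E -> \bar R) :
  (forall x, 0 <= f x) -> measurable_fun setT f ->
  \int[kpow P n.+1 u]_x f x =
  \int[B u]_v \int[kpow Q n v]_w \int[A w]_x f x.
Proof.
move=> f0 mf.
have Af0 w : 0 <= \int[A w]_x f x by exact: integral_ge0.
have mAf : measurable_fun setT (fun w => \int[A w]_x f x).
  exact: measurable_integral_pker.
elim: n u => [|n IHn] u.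
  rewrite integral_kseq//.
  under eq_integral do rewrite integral_kdirac//.
  by rewrite PE//; apply: eq_integral => v _; rewrite integral_kdirac.
(* By induction the remaining steps of [P] yield B g, and one more step gives P B g = B A B g = B Q
   g. *)
pose g v := \int[kpow Q n v]_w \int[A w]_x f x.
have g0 v : 0 <= g v by exact: integral_ge0.
have mg : measurable_fun setT g by exact: measurable_integral_pker.
rewrite [LHS]integral_kseq//; under eq_integral do rewrite IHn.
have Bg0 y : 0 <= \int[B y]_v g v by exact: integral_ge0.
have mBg : measurable_fun setT (fun y => \int[B y]_v g v).
  exact: measurable_integral_pker.
rewrite PE//; by apply: eq_integral => v _; rewrite [RHS]integral_kseq// QE.
Qed.

Lemma geometric_bound_intertwine rho :
  (0 < rho)%R -> geometric_bound Q pi' rho -> geometric_bound P pi rho.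
Proof.
move=> rho0 [M [M0 iM hM]].
have mM : measurable_fun setT M by exact: measurable_int iM.
have mBM : measurable_fun setT (fun u => \int[B u]_v M v).
  exact: measurable_integral_pker.
have BM0 u : 0 <= \int[B u]_v M v by exact: integral_ge0.
(* The factor [rho^-1] pays for the step lost in passing from P^(n+1) to Q^n; the summand 1 serves
   the case of a single step. *)
exists (fun u => (rho^-1)%:E * (\int[B u]_v M v + 1)); split.
- by move=> u; apply: mule_ge0; [rewrite lee_fin invr_ge0 ltW|exact: adde_ge0].
- apply: integrableZl => //; apply: integrableD => //; last first.
    exact: finite_measure_integrable_cst.
  apply/integrableP; split => //.
  under eq_integral do rewrite gee0_abs//.
  (* Since pi B = pi', the average of [M] under [B] has the same integral as [M]. *)
  rewrite -pi'E//; move/integrableP : iM => [_].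
  by under eq_integral do rewrite gee0_abs//.
move=> n u; case: n => // n _.
have -> : (rho^-1)%:E * (\int[B u]_v M v + 1) * (rho ^+ n.+1)%:E =
    (\int[B u]_v M v + 1) * (rho ^+ n)%:E.
  rewrite exprS EFinM muleACA -muleA muleCA.
  by rewrite muleA -EFinM mulfV ?gt_eqF// mul1e.
case: n => [|n].
  (* Here the middle factor is Q^0, which [hM] does not cover; the trivial bound 1 is used
     instead. *)
  rewrite expr0 mule1; apply: (@le_trans _ _ 1); last by rewrite leeDr.
  apply: total_variation_distance_le1; first exact: prob_kernel.
  exact: probability_setT.
apply: (@le_trans _ _ (\int[B u]_v (M v * (rho ^+ n.+1)%:E))); last first.
  have r0 : 0 < (rho ^+ n.+1)%:E by rewrite lte_fin exprn_gt0.
  rewrite (ge0_integralZr _ _ _ _ (ltW r0))//.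
  by apply: lee_wpmul2r; [exact: ltW|rewrite leeDl].
apply: ge_ereal_sup => _ [f [mf f01] <-].
have mEf : measurable_fun setT (EFin \o f) by exact/measurable_EFinP.
have Ef0 x : 0 <= (f x)%:E by have /andP[] := f01 x.
have mAf : measurable_fun setT (fun w => \int[A w]_x (f x)%:E).
  exact: measurable_integral_pker.
have Af01 w : 0 <= \int[A w]_x (f x)%:E <= 1.
  by apply: le1_integral => //; exact: prob_kernel.
have Af0 w : 0 <= \int[A w]_x (f x)%:E by exact: integral_ge0.
(* Both integrals of [f] become integrals of A f, again [0, 1]-valued and so an admissible test
   function for [Q]. *)
rewrite integral_kpowS// piE//.
pose g v := \int[kpow Q n.+1 v]_w \int[A w]_x (f x)%:E.
have mg : measurable_fun setT g.
  exact: measurable_integral_pker.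
have g01 v : 0 <= g v <= 1 by apply: le1_integral => //; exact: prob_kernel.
have /andP[c0 c1] := le1_integral (probability_setT pi') mAf Af01.
pose c := \int[pi']_w \int[A w]_x (f x)%:E.
have cfin : c \is a fin_num by rewrite ge0_fin_numE// (le_lt_trans c1)// ltry.
apply: (@le_trans _ _ (\int[B u]_v `|g v - c|)).
  by apply: abse_integralB_cst_le => //; exact: prob_kernel.
apply: ge0_le_integral => //.
- by apply: measurableT_comp => //; exact: emeasurable_funB.
- exact: emeasurable_funM.
- move=> v _; apply: le_trans (hM n.+1 v _) => //.
  exact: le_total_variation_distance.
Qed.

End intertwining.

(** * Ergodicity and convergence rates under transfer of bounds *)

Section geometric_bound_monotone.
Context d (E : measurableType d) (R : realType).
Variables (P : R.-pker E ~> E) (pi : probability E R).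

Lemma geometric_bound_le (rho rho' : R) : (0 <= rho <= rho')%R ->
  geometric_bound P pi rho -> geometric_bound P pi rho'.
Proof.
move=> /andP[rho0 le_rho] [M [M0 iM hM]]; exists M; split=> // n u n0.
apply: le_trans (hM n u n0) _; apply: lee_wpmul2l => //.
by rewrite lee_fin lerXn2r// nnegrE (le_trans rho0).
Qed.

End geometric_bound_monotone.

Section geometric_rates.
Context d d' (E : measurableType d) (F : measurableType d') (R : realType).
Variables (P : R.-pker E ~> E) (Q : R.-pker F ~> F).
Variables (pi : probability E R) (pi' : probability F R).
Hypothesis QP : forall rho : R,
  (0 < rho)%R -> geometric_bound Q pi' rho -> geometric_bound P pi rho.

Lemma geometrically_ergodic_le :
  geometrically_ergodic Q pi' -> geometrically_ergodic P pi.
Proof.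
(* [rho] may be 0 while [QP] needs a positive rate; the midpoint with 1 is positive, at least [rho]
   and still below 1. *)
move=> [rho /andP[rho0 rho1] Qrho]; exists ((rho + 1) / 2)%R.
  by apply/andP; split; lra.
apply: QP; first by lra.
by apply: geometric_bound_le Qrho; lra.
Qed.

Lemma geometric_rate_le :
  geometrically_ergodic Q pi' ->
  (geometric_rate P pi <= geometric_rate Q pi')%R.
Proof.
(* Ergodicity of [Q] makes its set of rates nonempty, so that [inf] is not a default value. *)
move=> [rho /andP[rho0 rho1] Qrho]; apply: lb_le_inf.
  by exists rho; split=> //; rewrite rho0 ltW.
move=> r [/andP[r0 r1] Qr]; apply/ler_addgt0Pr => e e0.
(* r may be 0, where [QP] says nothing, hence the detour through s > 0. *)
pose s := Num.min (r + e)%R 1%R.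
have rs : (r <= s)%R by rewrite le_min r1 andbT; lra.
have s0 : (0 < s)%R by rewrite lt_min ltr01 andbT; lra.
apply: (@le_trans _ _ s); last by rewrite ge_min lexx.
apply: ge_inf; first by exists 0%R => t [/andP[]].
split; first by rewrite (ltW s0) ge_min lexx orbT.
by apply: QP => //; apply: geometric_bound_le Qr; rewrite r0.
Qed.

End geometric_rates.

(** * Factorization of the two Gibbs sweeps *)

Section gibbs_sweep.
Context dX dY dZ (X : measurableType dX) (Y : measurableType dY)
  (Z : measurableType dZ) (R : realType).
Variables (Pi : probability (X * Y * Z)%type R) (PiX_Z : R.-pker Z ~> X)
  (PiY_XZ : R.-pker (X * Z) ~> Y) (PiZ_XY : R.-pker (X * Y) ~> Z).

(** The Dirac factor carries the retained y and z over to the coordinate order of the other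
    chain. *)
Definition update_X : R.-pker (X * Y * Z) ~> (Y * Z * X)%type :=
  kprod (kdirac (@measurable_funPT _ _ _ _ (@coordYZ _ _ _ X Y Z)))
    (kpull (snd \o snd) PiX_Z).

Definition update_YZ : R.-pker (Y * Z * X) ~> (X * Y * Z)%type :=
  kprod (kprod (kdirac (@measurable_snd _ _ (Y * Z)%type X))
           (kpull (@pair_xz _ _ _ X Y Z \o fst) PiY_XZ))
    (kpull snd PiZ_XY).

Lemma integral_update_X w (f : Y * Z * X -> \bar R) :
  (forall v, 0 <= f v) -> measurable_fun setT f ->
  \int[update_X w]_v f v = \int[PiX_Z (coordZ w)]_x f (coordYZ w, x).
Proof.
move=> f0 mf; rewrite integral_kprod// integral_kdirac//.
exact: (measurable_fun_integral_sfinite_kernel f (kpull snd PiX_Z)).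
Qed.

Lemma integral_update_YZ v (f : X * Y * Z -> \bar R) :
  (forall w, 0 <= f w) -> measurable_fun setT f ->
  \int[update_YZ v]_w f w =
  \int[PiY_XZ (pair_xz v)]_y \int[PiZ_XY (v.2, y)]_z f (v.2, y, z).
Proof.
move=> f0 mf.
have mf' : measurable_fun setT (fun u => \int[PiZ_XY u]_z f (u, z)).
  exact: (measurable_fun_integral_sfinite_kernel f PiZ_XY).
have f'0 u : 0 <= \int[PiZ_XY u]_z f (u, z) by exact: integral_ge0.
rewrite [LHS]integral_kprod//.
rewrite [LHS]integral_kprod// integral_kdirac//.
exact: (measurable_fun_integral_sfinite_kernel
  (fun u => \int[PiZ_XY u]_z f (u, z)) (kpull (cst (pair_xz v)) PiY_XZ)).
Qed.

(** The sweep draws x', y', z' in this order; it is cut after x'. *)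
Lemma integral_K_tilde w (f : X * Y * Z -> \bar R) :
  (forall w, 0 <= f w) -> measurable_fun setT f ->
  \int[K_tilde PiX_Z PiY_XZ PiZ_XY w]_u f u =
  \int[update_X w]_v \int[update_YZ v]_u f u.
Proof.
move=> f0 mf.
have mf' : measurable_fun setT (fun u => \int[PiZ_XY u]_z f (u, z)).
  exact: (measurable_fun_integral_sfinite_kernel f PiZ_XY).
have f'0 u : 0 <= \int[PiZ_XY u]_z f (u, z) by exact: integral_ge0.
rewrite integral_update_X; last 2 first.
- by move=> v; exact: integral_ge0.
- exact: measurable_integral_pker.
under [RHS]eq_integral do rewrite integral_update_YZ//.
by rewrite [LHS]integral_kprod// [LHS]integral_kprod.
Qed.

(** The sweep draws y', z', x' in this order; it is cut after z'. *)
Lemma integral_K_star v (f : Y * Z * X -> \bar R) :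
  (forall v, 0 <= f v) -> measurable_fun setT f ->
  \int[K_star PiX_Z PiY_XZ PiZ_XY v]_u f u =
  \int[update_YZ v]_w \int[update_X w]_u f u.
Proof.
move=> f0 mf.
have mf' : measurable_fun setT (fun u => \int[PiX_Z u.2]_x f (u, x)).
  exact: (measurable_fun_integral_sfinite_kernel f (kpull snd PiX_Z)).
have f'0 u : 0 <= \int[PiX_Z u.2]_x f (u, x) by exact: integral_ge0.
rewrite integral_update_YZ; last 2 first.
- by move=> w; exact: integral_ge0.
- exact: measurable_integral_pker.
transitivity (\int[kprod (kpull (@pair_xz _ _ _ X Y Z) PiY_XZ)
    (kpull (@pair_xy' _ _ _ X Y Z) PiZ_XY) v]_u \int[PiX_Z u.2]_x f (u, x)).
  exact: integral_kprod.
rewrite (integral_kprod _ _ _ f'0 mf').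
apply: eq_integral => y _; apply: eq_integral => z _.
by rewrite integral_update_X.
Qed.

Lemma integral_Pi_star (f : Y * Z * X -> \bar R) :
  (forall v, 0 <= f v) -> measurable_fun setT f ->
  \int[Pi_star Pi PiX_Z]_v f v = \int[Pi]_w \int[update_X w]_v f v.
Proof.
move=> f0 mf; rewrite integral_mprod//.
have mf' : measurable_fun setT (fun u => \int[PiX_Z u.2]_x f (u, x)).
  exact: (measurable_fun_integral_sfinite_kernel f (kpull snd PiX_Z)).
have f'0 u : 0 <= \int[PiX_Z u.2]_x f (u, x) by exact: integral_ge0.
rewrite ge0_integral_distribution//.
by apply: eq_integral => w _; rewrite integral_update_X.
Qed.

(** Starting from [Pi], the coordinates z, y and x are replaced in turn by draws from their
    conditional laws; the result, read backwards, is [update_X] followed by [update_YZ]. *)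
Lemma integral_Pi (f : X * Y * Z -> \bar R) :
  conditional_law Pi (@coordX _ _ _ X Y Z) (@coordZ _ _ _ X Y Z) PiX_Z ->
  conditional_law Pi (@coordY _ _ _ X Y Z) (@coordXZ _ _ _ X Y Z) PiY_XZ ->
  conditional_law Pi (@coordZ _ _ _ X Y Z) (@coordXY _ _ _ X Y Z) PiZ_XY ->
  (forall v, 0 <= f v) -> measurable_fun setT f ->
  \int[Pi]_w f w = \int[Pi_star Pi PiX_Z]_v \int[update_YZ v]_w f w.
Proof.
move=> condX condY condZ f0 mf.
have mX : measurable_fun setT (@coordX _ _ _ X Y Z).
  exact: (measurableT_comp measurable_fst measurable_fst).
have mY : measurable_fun setT (@coordY _ _ _ X Y Z).
  exact: (measurableT_comp measurable_snd measurable_fst).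
have mZ : measurable_fun setT (@coordZ _ _ _ X Y Z) by [].
have mXZ : measurable_fun setT (@coordXZ _ _ _ X Y Z).
  exact: measurable_fun_pair.
have mXY : measurable_fun setT (@coordXY _ _ _ X Y Z).
  exact: measurable_fun_pair.
rewrite integral_Pi_star; last 2 first.
- by move=> v; exact: integral_ge0.
- exact: measurable_integral_pker.
pose g u := \int[PiZ_XY u]_z f (u, z).
have g0 u : 0 <= g u by exact: integral_ge0.
have mg : measurable_fun setT g.
  exact: (measurable_fun_integral_sfinite_kernel f PiZ_XY).
(* [g'], and [h'] below, put the arguments in the shape (conditioning variable, drawn variable) of
   [integral_conditional_law]. *)
pose g' (s : X * Z * Y) := g (s.1.1, s.2).
have mg' : measurable_fun setT g'.
  apply: measurableT_comp => //; apply: measurable_fun_pair => //.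
  exact: (measurableT_comp measurable_fst measurable_fst).
have g'0 s : 0 <= g' s by exact: g0.
pose h (u : X * Z) := \int[PiY_XZ u]_y g' (u, y).
have h0 u : 0 <= h u by exact: integral_ge0.
have mh : measurable_fun setT h.
  exact: (measurable_fun_integral_sfinite_kernel g' PiY_XZ g'0).
pose h' (s : Z * X) := h (s.2, s.1).
have mh' : measurable_fun setT h'.
  apply: (measurableT_comp mh).
  exact: (measurable_fun_pair measurable_snd measurable_fst).
transitivity (\int[Pi]_w g (coordXY w)).
  rewrite (integral_conditional_law mZ mXY condZ)//.
  by apply: eq_integral => -[[x y] z].
transitivity (\int[Pi]_w h (coordXZ w)).
  by rewrite (integral_conditional_law mY mXZ condY (f := g')).
transitivity (\int[Pi]_w \int[PiX_Z (coordZ w)]_x h' (coordZ w, x)).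
  by rewrite (integral_conditional_law mX mZ condX (fun=> h0 _) mh').
apply: eq_integral => w _; rewrite integral_update_X.
- by apply: eq_integral => x _; rewrite integral_update_YZ.
- by move=> v; exact: integral_ge0.
- exact: measurable_integral_pker.
Qed.

End gibbs_sweep.

Local Open Scope ring_scope.

Theorem proposition4 (R : realType) (dX dY dZ : measure_display)
  (X : measurableType dX) (Y : measurableType dY) (Z : measurableType dZ)
  (Pi : probability (X * Y * Z)%type R)
  (PiX_Z : R.-pker Z ~> X)
  (PiY_XZ : R.-pker (X * Z) ~> Y)
  (PiZ_XY : R.-pker (X * Y) ~> Z)
  (K := K_tilde PiX_Z PiY_XZ PiZ_XY)
  (Kstar := K_star PiX_Z PiY_XZ PiZ_XY)
  (Pistar := Pi_star Pi PiX_Z) :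
  countably_generated X -> countably_generated Y -> countably_generated Z ->
  conditional_law Pi (@coordX _ _ _ X Y Z) (@coordZ _ _ _ X Y Z) PiX_Z ->
  conditional_law Pi (@coordY _ _ _ X Y Z) (@coordXZ _ _ _ X Y Z) PiY_XZ ->
  conditional_law Pi (@coordZ _ _ _ X Y Z) (@coordXY _ _ _ X Y Z) PiZ_XY ->
  irreducible_aperiodic_positive_harris K ->
  irreducible_aperiodic_positive_harris Kstar ->
  irreducible_aperiodic_positive_harris (K_XY PiX_Z PiY_XZ PiZ_XY) ->
  irreducible_aperiodic_positive_harris (K_Z PiX_Z PiY_XZ PiZ_XY) ->
  [/\ geometrically_ergodic K Pi, geometrically_ergodic Kstar Pistar
    & geometric_rate K Pi = geometric_rate Kstar Pistar]
  \/ (~ geometrically_ergodic K Pi /\ ~ geometrically_ergodic Kstar Pistar).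
Proof.
move=> _ _ _ condX condY condZ _ _ _ _.
have KstarK rho : (0 < rho)%R ->
    geometric_bound Kstar Pistar rho -> geometric_bound K Pi rho.
  apply (@geometric_bound_intertwine _ _ _ _ _ K Kstar (update_X Y PiX_Z)
    (update_YZ PiY_XZ PiZ_XY) Pi Pistar).
  - exact: integral_K_tilde.
  - exact: integral_K_star.
  - exact: integral_Pi_star.
  - by move=> f; exact: integral_Pi.
(* Exchanging the two updates exchanges the chains and their invariant laws, so the same lemma gives
   the converse transfer. *)
have KKstar rho : (0 < rho)%R ->
    geometric_bound K Pi rho -> geometric_bound Kstar Pistar rho.
  apply (@geometric_bound_intertwine _ _ _ _ _ Kstar K
    (update_YZ PiY_XZ PiZ_XY) (update_X Y PiX_Z) Pistar Pi).
  - exact: integral_K_star.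
  - exact: integral_K_tilde.
  - by move=> f; exact: integral_Pi.
  - exact: integral_Pi_star.
have [gK|ngK] := pselect (geometrically_ergodic K Pi); last first.
  by right; split=> // /(geometrically_ergodic_le KstarK).
have gKstar := geometrically_ergodic_le KKstar gK.
left; split=> //; apply/eqP; rewrite eq_le.
by rewrite (geometric_rate_le KstarK)// (geometric_rate_le KKstar).
Qed.
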